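(* Let $(\mathfrak g,\mathfrak v,\pi)$ be a Lorentzian data set. Decompose $\mathfrak g=\overline{\mathfrak g}\oplus\mathfrak c$, where $\overline{\mathfrak g}=[\mathfrak g,\mathfrak g]$ is compact semisimple and $\mathfrak c$ is the center of $\mathfrak g$. Let $\mathfrak h^{\mathrm{aut}}$ be the Lie algebra of skew-symmetric derivations of the metric Lie algebra $\mathfrak n=\mathfrak n(\mathfrak g,\mathfrak v,\pi)=\mathfrak g\oplus\mathfrak v$. Then $$\mathfrak h^{\mathrm{aut}}=\overline{\mathfrak g}\oplus\mathfrak u,\qquad [\overline{\mathfrak g},\mathfrak u]=0,$$ where $\mathfrak u=\mathrm{End}_\pi(\mathfrak v)\cap\mathfrak{so}(\mathfrak v)=\{B\in\mathfrak{so}(\mathfrak v):[B,\pi(Z)]=0\text{ for every }Z\in\mathfrak g\}$, and $\overline{\mathfrak g}$ acts on $\mathfrak n=\mathfrak g\oplus\mathfrak v$ as $(\mathrm{ad}(Z),\pi(Z))$ for every $Z\in\overline{\mathfrak g}$.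
   Context: All vector spaces and Lie algebras are real and finite-dimensional; ''metric'' or ''inner product'' means a non-degenerate symmetric bilinear form, not necessarily definite. $\mathfrak{so}(V)$ is the Lie algebra of skew-symmetric endomorphisms of $V$ with respect to its metric. A data set is a triple $(\mathfrak g,\mathfrak v,\pi)$ where: $\mathfrak g$ is a Lie algebra with an ad-invariant metric $\langle\cdot,\cdot\rangle_{\mathfrak g}$ (i.e. $\mathrm{ad}_Z\in\mathfrak{so}(\mathfrak g)$ for all $Z\in\mathfrak g$); $\mathfrak v$ is a real vector space; $\pi:\mathfrak g\to\mathrm{End}(\mathfrak v)$ is a real faithful representation without trivial subrepresentations, i.e. $\bigcap_{Z\in\mathfrak g}\ker\pi(Z)=\{0\}$; and $\mathfrak v$ has a $\pi(\mathfrak g)$-invariant inner product $\langle\cdot,\cdot\rangle_{\mathfrak v}$, i.e. $\pi(\mathfrak g)\subset\mathfrak{so}(\mathfrak v)$. The associated metric Lie algebra $\mathfrak n(\mathfrak g,\mathfrak v,\pi)$ is $\mathfrak n=\mathfrak g\oplus\mathfrak v$ with the orthogonal direct sum metric and the bracket determined by $[\mathfrak g,\mathfrak n]=0$, $[\mathfrak v,\mathfrak v]\subset\mathfrak g$, $\langle[X,Y],Z\rangle=\langle\pi(Z)X,Y\rangle$ for $X,Y\in\mathfrak v$, $Z\in\mathfrak g$; it is $2$-step nilpotent with center $\mathfrak g$. The data set is Lorentzian if the metric on $\mathfrak n$ has signature one (exactly one negative direction). In that case $\mathfrak g$ is a compact Lie algebra (isomorphic to the Lie algebra of a compact Lie group),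 so $\mathfrak g=[\mathfrak g,\mathfrak g]\oplus\mathfrak c$ with $[\mathfrak g,\mathfrak g]$ semisimple. $\mathrm{End}_\pi(\mathfrak v)$ is the set of endomorphisms of $\mathfrak v$ commuting with $\pi(Z)$ for all $Z\in\mathfrak g$. One has $\mathfrak h^{\mathrm{aut}}=\mathrm{Der}(\mathfrak n)\cap\mathfrak{so}(\mathfrak n)=\{(A,B)\in\mathfrak{so}(\mathfrak g)\times\mathfrak{so}(\mathfrak v):[B,\pi(Z)]=\pi(AZ)\ \text{for every } Z\in\mathfrak g\}$, where $(A,B)$ acts by $A$ on $\mathfrak g$ and by $B$ on $\mathfrak v$. In the claim, $\overline{\mathfrak g}$ is identified with $\{(\mathrm{ad}(Z),\pi(Z)):Z\in\overline{\mathfrak g}\}$ and $\mathfrak u$ with $\{(0,B):B\in\mathfrak u\}$, both inside $\mathfrak h^{\mathrm{aut}}$. *)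

(* Defs.v *)
From HB Require Import structures.
From mathcomp Require Import all_boot all_order all_algebra.
From mathcomp Require Import classical_sets reals.

Set Implicit Arguments.
Unset Strict Implicit.
Unset Printing Implicit Defensive.

Import Order.TTheory GRing.Theory Num.Theory.
Local Open Scope classical_set_scope.
Local Open Scope ring_scope.

Section LinfunOfLinear.
Variables (R : nzRingType) (U V : vectType R).

Lemma linfun_linearE (f : U -> V) : linear f -> linfun f =1 f.
Proof.
move=> flin x; pose fL := GRing.isLinear.Build _ _ _ _ f flin.
pose F : {linear U -> V} := HB.pack f fL.
exact: (lfunE F x).
Qed.

End LinfunOfLinear.

(* The bracket [x, y] is [L x y]; bilinearity is carried by the type. *)
Record lie_algebra (R : fieldType) (g : vectType R) := LieAlgebra {
  lie_ad :> 'Hom(g, 'End(g));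
  lie_alternating : forall x, lie_ad x x = 0;
  lie_jacobi : forall x y z,
    lie_ad x (lie_ad y z) + lie_ad y (lie_ad z x) + lie_ad z (lie_ad x y) = 0
}.

Definition commutator (R : fieldType) (V : vectType R) (A B : 'End(V)) : 'End(V) :=
  (A \o B)%VF - (B \o A)%VF.

Section LieTheory.
Variables (R : fieldType) (g : vectType R) (L : lie_algebra g).

(* The span of all [x, y] with x in U and y in W; by bilinearity it suffices to
   take x and y in bases, see [mem_lie_prod]. *)
Definition lie_prod (U W : {vspace g}) : {vspace g} :=
  <<[seq L x y | x <- vbasis U, y <- vbasis W]>>%VS.

Lemma mem_lie_prod (U W : {vspace g}) (x y : g) :
  x \in U -> y \in W -> L x y \in lie_prod U W.
Proof.
move=> xU yW; rewrite (coord_vbasis xU) (coord_vbasis yW).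
rewrite linear_sum memv_suml // => j _; rewrite linearZ memvZ //=.
rewrite linear_sum sum_lfunE memv_suml // => i _.
rewrite linearZ scale_lfunE memvZ //; apply/memv_span/allpairs_f.
  by apply: mem_nth; rewrite size_tuple.
by apply: mem_nth; rewrite size_tuple.
Qed.

Definition lie_derived : {vspace g} := lie_prod fullv fullv.

Definition lie_center : {vspace g} := lker L.

Definition lie_ideal (W I : {vspace g}) : Prop :=
  (I <= W)%VS /\ (lie_prod W I <= I)%VS.

Definition lie_solvable (I : {vspace g}) : Prop :=
  exists k, iter k (fun J => lie_prod J J) I = 0%VS.

Definition lie_semisimple (W : {vspace g}) : Prop :=
  forall I, lie_ideal W I -> lie_solvable I -> I = 0%VS.

Definition lie_derivation : set 'End(g) :=
  [set D | forall x y, D (L x y) = L (D x) y + L x (D y)].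

End LieTheory.

(* A subalgebra W of a real Lie algebra is the Lie algebra of a compact Lie group
   if and only if it has an ad-invariant positive definite inner product; the
   latter is taken as the definition. *)
Definition lie_compact (R : realType) (g : vectType R) (L : lie_algebra g)
    (W : {vspace g}) : Prop :=
  exists h : {symmetric g},
    (forall x, x \in W -> x != 0 -> 0 < h x x) /\
    {in W & &, forall z x y, h (L z x) y = - h x (L z y)}.

Record metric (R : fieldType) (V : vectType R) := Metric {
  metric_form :> {symmetric V};
  metric_nondegenerate : nondegenerate metric_form
}.

Section MetricTheory.
Variables (R : fieldType) (V : vectType R) (M : metric V).

Lemma metricC x y : M x y = M y x.
Proof. by rewrite (@hermC R false idfun V M x y) expr0 mul1r. Qed.

Lemma metric_eq0 x : (forall y, M x y = 0) -> x = 0.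
Proof.
move=> Mx0; apply/eqP; rewrite -memv0.
rewrite -(eqP (metric_nondegenerate M)).
by apply: (introT (mem_orthovP (form := M))) => y _; exact: Mx0.
Qed.

Definition skew : set 'End(V) := [set A | forall x y, M (A x) y = - M x (A y)].

Definition flat : 'Hom(V, 'Hom(V, R^o)) :=
  linfun (fun x => linfun (M x : V -> R^o)).

Lemma flatE x y : flat x y = M x y.
Proof.
have lin1 z : linear (M z : V -> R^o).
  by move=> a u w; rewrite linearDr linearZr_LR.
rewrite /flat linfun_linearE ?linfun_linearE // => a u w.
apply/lfunP => z; rewrite add_lfunE scale_lfunE !linfun_linearE //.
by rewrite linearDl linearZl_LR.
Qed.

Lemma lker_flat : lker flat = 0%VS.
Proof.
apply/eqP/lker0P => x y exy; apply/eqP; rewrite -subr_eq0; apply/eqP.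
apply: metric_eq0 => z; rewrite linearBl /=.
by have := flatE x z; rewrite exy flatE => ->; rewrite subrr.
Qed.

(* The vector representing a linear form with respect to the metric. *)
Definition sharp : 'Hom('Hom(V, R^o), V) := (flat^-1)%VF.

Lemma sharpE f y : M (sharp f) y = f y.
Proof.
rewrite -flatE /sharp limg_lfunVK //.
suff -> : limg flat = fullv by rewrite memvf.
apply/eqP; rewrite eqEdim subvf /= limg_dim_eq ?lker_flat ?capv0 //.
by rewrite !dimvf /dim /= muln1.
Qed.

End MetricTheory.

Definition negative_definite (R : realType) (V : vectType R) (M : metric V)
    (U : {vspace V}) : Prop :=
  forall x, x \in U -> x != 0 -> M x x < 0.

(* k is the largest dimension of a negative definite subspace. *)
Definition metric_index (R : realType) (V : vectType R) (M : metric V)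
    (k : nat) : Prop :=
  (exists U, negative_definite M U /\ \dim U = k) /\
  (forall U, negative_definite M U -> (\dim U <= k)%N).

Record data_set (R : realType) (g v : vectType R) := DataSet {
  ds_lie : lie_algebra g;
  ds_gmetric : metric g;
  ds_vmetric : metric v;
  ds_pi : 'Hom(g, 'End(v));
  ds_gmetric_invariant : forall Z, skew ds_gmetric (ds_lie Z);
  ds_pi_morph : forall Z W,
    ds_pi (ds_lie Z W) = commutator (ds_pi Z) (ds_pi W);
  ds_pi_faithful : injective ds_pi;
  ds_pi_no_trivial : forall X, (forall Z, ds_pi Z X = 0) -> X = 0;
  ds_vmetric_invariant : forall Z, skew ds_vmetric (ds_pi Z)
}.

Section ProductMetric.
Variables (R : fieldType) (V W : vectType R) (MV : metric V) (MW : metric W).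

Definition prod_form (p q : V * W) : R := MV p.1 q.1 + MW p.2 q.2.

Lemma prod_form_bilinear : bilinear_for *%R *%R prod_form.
Proof.
split=> [p|p] a x y; rewrite /prod_form /=.
  by rewrite !linearDl !linearZl_LR /= mulrDr addrACA.
by rewrite !linearDr !linearZr_LR /= mulrDr addrACA.
Qed.

HB.instance Definition _ :=
  bilinear_isBilinear.Build R _ _ _ *%R *%R prod_form prod_form_bilinear.

Lemma prod_form_sym p q : prod_form p q = (-1) ^+ false * idfun (prod_form q p).
Proof. by rewrite expr0 mul1r /prod_form metricC [MW _ _]metricC. Qed.

HB.instance Definition _ :=
  isHermitianSesquilinear.Build R _ false idfun prod_form prod_form_sym.

Lemma prod_form_nondegenerate : nondegenerate (prod_form : {symmetric (V * W)%type}).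
Proof.
rewrite /nondegenerate -subv0; apply/subvP => p /mem_orthovP p0.
rewrite memv0; apply/eqP; case: p p0 => x y p0.
have -> : x = 0.
  apply: (@metric_eq0 _ _ MV) => z; have := p0 (z, 0) (memvf _).
  by rewrite /= /prod_form /= linear0r addr0.
have -> // : y = 0.
apply: (@metric_eq0 _ _ MW) => z; have := p0 (0, z) (memvf _).
by rewrite /= /prod_form /= linear0r add0r.
Qed.

Definition prod_metric : metric (V * W)%type :=
  @Metric _ (V * W)%type (prod_form : {symmetric (V * W)%type}) prod_form_nondegenerate.

(* The pair (A, B) of endomorphisms, acting diagonally. *)
Definition pair_end (A : 'End(V)) (B : 'End(W)) : 'End((V * W)%type) :=
  linfun (fun p => (A p.1, B p.2)).

Lemma pair_endE A B p : pair_end A B p = (A p.1, B p.2).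
Proof.
rewrite linfun_linearE // => a x y /=.
by rewrite !linearD !linearZ.
Qed.

End ProductMetric.

Section NilpotentLieAlgebra.
Variables (R : realType) (g v : vectType R) (D : data_set g v).
Local Notation n := (g * v)%type.
Local Notation Lg := (ds_lie D).
Local Notation Mg := (ds_gmetric D).
Local Notation Mv := (ds_vmetric D).
Local Notation pi := (ds_pi D).

Definition n_pairing (X Y : v) : 'Hom(g, R^o) :=
  linfun (fun Z => Mv (pi Z X) Y : R^o).

Lemma n_pairingE X Y Z : n_pairing X Y Z = Mv (pi Z X) Y.
Proof.
rewrite linfun_linearE // => a x y.
by rewrite linearD linearZ add_lfunE scale_lfunE linearDl linearZl_LR.
Qed.

Definition n_bracket (p q : n) : n := (sharp Mg (n_pairing p.2 q.2), 0).

Definition n_ad : 'Hom(n, 'End(n)) := linfun (fun p => linfun (n_bracket p)).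

Lemma n_adE p q : n_ad p q = n_bracket p q.
Proof.
have linr r : linear (n_bracket r).
  move=> a x y; rewrite /n_bracket; congr (_, _); last by rewrite /= scaler0 addr0.
  rewrite /= -[RHS]linearP; congr (fun_of_lfun _ _); apply/lfunP => Z.
  rewrite add_lfunE scale_lfunE !n_pairingE.
  by rewrite linearDr linearZr_LR.
rewrite /n_ad linfun_linearE ?linfun_linearE // => a x y.
apply/lfunP => r; rewrite add_lfunE scale_lfunE !linfun_linearE //.
rewrite /n_bracket; congr (_, _); last by rewrite /= scaler0 addr0.
rewrite /= -[RHS]linearP; congr (fun_of_lfun _ _); apply/lfunP => Z.
rewrite add_lfunE scale_lfunE !n_pairingE.
by rewrite linearD linearZ linearDl linearZl_LR.
Qed.

Lemma n_ad_alternating p : n_ad p p = 0.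
Proof.
rewrite n_adE /n_bracket; suff -> : n_pairing p.2 p.2 = 0 by rewrite linear0.
apply/lfunP => Z; rewrite n_pairingE zero_lfunE.
have := ds_vmetric_invariant D Z p.2 p.2.
rewrite [in RHS]metricC => /eqP; rewrite -addr_eq0 -mulr2n mulrn_eq0 /=.
by move/eqP.
Qed.

Lemma n_ad_center p q r : n_ad p (n_ad q r) = 0.
Proof.
rewrite !n_adE /n_bracket /=; suff -> : n_pairing p.2 0 = 0 by rewrite linear0.
by apply/lfunP => Z; rewrite n_pairingE zero_lfunE linear0r.
Qed.

Lemma n_ad_jacobi p q r :
  n_ad p (n_ad q r) + n_ad q (n_ad r p) + n_ad r (n_ad p q) = 0.
Proof. by rewrite !n_ad_center !addr0. Qed.

Definition n_lie : lie_algebra n := LieAlgebra n_ad_alternating n_ad_jacobi.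

Definition n_metric : metric n := prod_metric Mg Mv.

(* The properties that determine the bracket of n. *)
Lemma n_lie_central (Z : g) (p : n) : n_lie (Z, 0) p = 0.
Proof.
rewrite /= n_adE /n_bracket /=; suff -> : n_pairing 0 p.2 = 0 by rewrite linear0.
by apply/lfunP => W; rewrite n_pairingE zero_lfunE linear0 linear0l.
Qed.

Lemma n_lie_range (X Y : v) : (n_lie (0, X) (0, Y)).2 = 0.
Proof. by rewrite /= n_adE. Qed.

Lemma n_lie_pairing (X Y : v) (Z : g) :
  n_metric (n_lie (0, X) (0, Y)) (Z, 0) = Mv (pi Z X) Y.
Proof.
rewrite /= n_adE /= /prod_form /= linear0r addr0 sharpE.
exact: n_pairingE.
Qed.

Definition lorentzian : Prop := metric_index n_metric 1.

Definition End_pi : set 'End(v) :=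
  [set B | forall Z, (B \o pi Z)%VF = (pi Z \o B)%VF].

Definition h_aut : set 'End(n) := lie_derivation n_lie `&` skew n_metric.

Definition u_alg : set 'End(v) := End_pi `&` skew Mv.

Definition g_action (Z : g) : 'End(n) := pair_end (Lg Z) (pi Z).

Definition gbar_n : set 'End(n) := [set g_action Z | Z in [set` lie_derived Lg]].

Definition u_n : set 'End(n) := [set pair_end 0 B | B in u_alg].

End NilpotentLieAlgebra.

(* Main.v *)
Require Import Defs.
From HB Require Import structures.
From mathcomp Require Import all_boot all_order all_algebra.
From mathcomp Require Import classical_sets reals.
From mathcomp Require Import zify ring lra.

Set Implicit Arguments.
Unset Strict Implicit.
Unset Printing Implicit Defensive.

Import Order.TTheory GRing.Theory Num.Theory.
Local Open Scope classical_set_scope.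
Local Open Scope ring_scope.

(** Since n has index one, it cannot contain two orthogonal negative vectors, so
    g or v is positive definite.  If g is, its own metric is a positive definite
    ad-invariant form; if v is, so is minus the trace form of pi, because pi is
    faithful and skew ([exists_invariant_positive]).  Such a form h gives the
    structure of g: the h-orthogonal complement of [g, g] is the center c, and an
    abelian ideal of [g, g] is central, hence zero, which excludes nonzero
    solvable ideals by descending the derived series ([derived_semisimple]).

    A skew derivation T of n preserves the center g of n and therefore its
    orthogonal complement v, so T = (A, B) with A and B skew and
    [B, pi Z] = pi (A Z) ([h_aut_pair], [h_autP]).  As pi is faithful, A is a
    derivation of g.  If A vanishes on c, then A is ad Z for some Z in [g, g], by
    the usual argument with the Killing form, which is negative definite on
    [g, g] ([derivation_inner]); then B - pi Z commutes with pi(g), and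
    T = (ad Z, pi Z) + (0, B - pi Z) is the required decomposition.

    The heart of the proof is that A vanishes on c ([h_aut_center_eq0]).  Let Z be
    in c and N = pi (A Z) = [B, pi Z].  A derivation preserves c, so pi Z, N and
    [B, N] = pi (A (A Z)) commute, and differentiating a polynomial relation
    satisfied by pi Z shows that N is nilpotent ([commutator_nilpotent]).
    Moreover N is skew and commutes with pi(g).  In a space of index at most one
    totally isotropic subspaces have dimension at most one
    ([null_collinear]).  If N^2 were not zero, some power P of it would be nonzero
    and symmetric with P^2 = 0; the image of P would be an isotropic line stable
    under pi(g), and in fact killed by it ([sym_square_eq0]), contrary to the
    absence of trivial subrepresentations.  So N^2 = 0, and then N = 0 because a
    nonzero skew endomorphism cannot have an isotropic line as image
    ([skew_square_eq0]).  Hence pi (A Z) = 0 and A Z = 0. *)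

(** * Nilpotency of commutators *)

Section NilpotentCommutator.
Variables (F : numFieldType) (E : algType F).
Implicit Types (X Y B N : E) (p : {poly F}).

Lemma comm_horner_alg X Y p : GRing.comm X Y -> GRing.comm (horner_alg X p) Y.
Proof.
move=> cXY; apply: commr_sym; elim/poly_ind: p => [|p c IHp].
  by rewrite rmorph0; apply: commr0.
rewrite rmorphD rmorphM /= horner_algX horner_algC.
apply: commrD; first by apply: commrM => //; apply: commr_sym.
by rewrite /GRing.comm -scalerAl -scalerAr mulr1 mul1r.
Qed.

(** The inner derivation of B sends X to N; as N commutes with X, it acts on
    polynomials in X by the chain rule. *)
Lemma commutator_horner_alg X B N p :
  N = X * B - B * X -> GRing.comm X N ->
  horner_alg X p * B - B * horner_alg X p = horner_alg X p^`() * N.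
Proof.
move=> defN cXN; elim/poly_ind: p => [|p c IHp].
  by rewrite deriv0 rmorph0 !(mul0r, mulr0) subrr.
rewrite derivD derivM derivX derivC addr0 mulr1.
rewrite !(rmorphD, rmorphM) /= horner_algX horner_algC !mulrDr !mulrDl.
have -> : c%:A * B = B * c%:A by rewrite -scalerAl -scalerAr mulr1 mul1r.
rewrite opprD addrACA subrr addr0 -[in RHS]mulrA cXN [in RHS]mulrA -IHp.
rewrite defN mulrBl mulrBr !mulrA.
by rewrite [RHS]addrC addrA subrK.
Qed.

(** If q(X) N^m = 0, then taking the bracket with B and multiplying by N gives
    q'(X) N^(m+2) = 0, since the term q(X) [N^m, B] N is a multiple of
    q(X) N^m N'.  In characteristic zero repeated differentiation of p reaches a
    nonzero constant. *)
Lemma nilpotent_of_annihilator X B N N' p :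
  N = X * B - B * X -> N' = N * B - B * N ->
  GRing.comm X N -> GRing.comm X N' -> GRing.comm N N' ->
  p != 0 -> horner_alg X p = 0 -> exists k, N ^+ k = 0.
Proof.
move=> defN defN' cXN cXN' cNN' p_neq0 pX0.
suff descent n m (q : {poly F}) : (size q <= n)%N -> q != 0 ->
    horner_alg X q * N ^+ m = 0 -> exists k, N ^+ k = 0.
  by apply: (descent (size p) 0%N p); rewrite ?pX0 ?mul0r.
elim: n m q => [|n IHn] m q.
  by rewrite leqn0 size_poly_eq0 => /eqP->; rewrite eqxx.
move=> size_q q_neq0 qN0.
have [q_const | q_nconst] := leqP (size q) 1.
  move: q_neq0 qN0; rewrite (size1_polyC q_const) horner_algC polyC_eq0 => c_neq0.
  rewrite -scalerAl mul1r => /eqP; rewrite scaler_eq0 (negPf c_neq0) /= => /eqP.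
  by exists m.
have dq_neq0 : q^`() != 0.
  apply/eqP => dq0; have := congr1 (fun r : {poly F} => r`_(size q).-2) dq0.
  rewrite coef_deriv coef0 => /eqP; rewrite mulrn_eq0 /=.
  rewrite -[X in q`_X]/((size q).-2.+1) prednK; last by rewrite -ltnS prednK // ltnW.
  by rewrite -lead_coefE lead_coef_eq0 (negPf q_neq0).
apply: (IHn m.+2 q^`()) => //.
  by rewrite -ltnS (leq_trans (lt_size_deriv q_neq0)).
(* Bracket the relation q(X) N^m = 0 with B, then multiply by N on the right. *)
have qcomm := commutator_horner_alg q defN cXN.
have /esym Ncomm := commutator_horner_alg 'X^m defN' cNN'.
rewrite !rmorphXn /= !horner_algX in Ncomm.
have cNdN : GRing.comm (horner_alg N ('X^m)^`()) N by apply: comm_horner_alg.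
have dNN : horner_alg N ('X^m)^`() * N = N ^+ m *+ m.
  rewrite derivXn; case: m {qN0 IHn Ncomm cNdN} => [|m].
    by rewrite !mulr0n rmorph0 mul0r.
  by rewrite rmorphMn rmorphXn /= horner_algX mulrnAl -exprSr.
have : (horner_alg X q * N ^+ m * B - B * (horner_alg X q * N ^+ m)) * N = 0.
  by rewrite qN0 mul0r mulr0 subrr mul0r.
have -> : horner_alg X q * N ^+ m * B - B * (horner_alg X q * N ^+ m) =
    (horner_alg X q * B - B * horner_alg X q) * N ^+ m +
    horner_alg X q * (N ^+ m * B - B * N ^+ m).
  by rewrite mulrBl mulrBr !mulrA [RHS]addrC addrA subrK.
rewrite qcomm -Ncomm mulrDl -!mulrA -exprSr -exprS -cNN' [_ * (N * N')]mulrA dNN.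
have -> : horner_alg X q * (N ^+ m *+ m * N') = 0.
  by rewrite mulrnAl mulrnAr mulrA qN0 mul0r mul0rn.
by rewrite addr0.
Qed.

End NilpotentCommutator.

(** In the algebra of endomorphisms used here, products are compositions in the
    reverse order; this only exchanges the roles of the two factors in each
    commutator.  An annihilating polynomial of X exists because the powers of X
    are linearly dependent. *)
Lemma commutator_nilpotent (F : numFieldType) (V : vectType F) (B X N N' : 'End(V)) :
  commutator B X = N -> commutator B N = N' ->
  (X \o N = N \o X)%VF -> (X \o N' = N' \o X)%VF -> (N \o N' = N' \o N)%VF ->
  exists k, forall x, iter k N x = 0.
Proof.
move=> defN defN' cXN cXN' cNN'.
have [dim_gt0|] := boolP (0 < dim V)%N; last first.
  rewrite -leqNgt leqn0 => /eqP dim0; exists 0%N => x /=; apply/eqP.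
  rewrite -memv0; suff -> : (0 = fullv :> {vspace V})%VS by rewrite memvf.
  by apply/eqP; rewrite eqEdim sub0v dimvf dim0.
pose E : algType F := lfun_algType dim_gt0.
suff [p p_neq0 pX0] : exists2 p : {poly F}, p != 0 & horner_alg (X : E) p = 0.
  have [k Nk0] : exists k, (N : E) ^+ k = 0.
    exact: (@nilpotent_of_annihilator _ E X B N N' p (esym defN) (esym defN')
              (esym cXN) (esym cXN') (esym cNN') p_neq0 pX0).
  exists k => x; have <- : ((N : E) ^+ k : 'End(V)) x = iter k N x.
    elim: k {Nk0} => [|k IHk]; first exact: id_lfunE.
    by rewrite exprSr /= -IHk; exact: comp_lfunE.
  by rewrite Nk0; exact: zero_lfunE.
pose d := dim 'End(V).
have : ~~ free [tuple ((X : E) ^+ i : 'End(V)) | i < d.+1].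
  apply/negP; rewrite /free size_tuple => /eqP dimX.
  by have := dimvS (subvf <<[tuple ((X : E) ^+ i : 'End(V)) | i < d.+1]>>);
    rewrite dimX dimvf ltnn.
move=> /freeP nfree.
have [c [i ci_neq0 c0]] : exists c : 'I_d.+1 -> F, exists2 i, c i != 0 &
    \sum_(i < d.+1) c i *: ((X : E) ^+ i : 'End(V)) = 0.
  apply: boolp.contrapT => none; apply: nfree => c c0 i.
  have [//|ci] := eqVneq (c i) 0; case: none; exists c, i => //; rewrite -[RHS]c0.
  by apply: eq_bigr => j _; rewrite (nth_map j) ?size_enum_ord // nth_ord_enum.
exists (\poly_(i < d.+1) c (inord i)).
  apply/eqP => /(congr1 (fun r : {poly F} => r`_i)).
  by rewrite coef_poly ltn_ord inord_val coef0 => /eqP; rewrite (negPf ci_neq0).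
rewrite poly_def linear_sum -[RHS]c0; apply: eq_bigr => j _.
rewrite -mul_polyC rmorphM rmorphXn /= horner_algC horner_algX mulr_algl.
by rewrite inord_val.
Qed.

(** * Tight frames and trace forms *)

Definition positive_on (R : realType) (V : vectType R) (h : {symmetric V})
    (U : {vspace V}) : Prop :=
  forall x, x \in U -> x != 0 -> 0 < h x x.

Section Frames.
Variables (R : realType) (V : vectType R) (h : {symmetric V}).
Implicit Types (s : seq V) (S T Y : 'End(V)).

Lemma symmC x y : h x y = h y x.
Proof. by rewrite (@hermC R false idfun V h x y) expr0 mul1r. Qed.

Lemma positive_on_eq0 (U : {vspace V}) x :
  positive_on h U -> x \in U -> h x x = 0 -> x = 0.
Proof.
move=> hpos xU hxx; have [//|x_neq0] := eqVneq x 0.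
by have := hpos x xU x_neq0; rewrite hxx ltxx.
Qed.

Lemma positive_on_ge0 (U : {vspace V}) x : positive_on h U -> x \in U -> 0 <= h x x.
Proof.
move=> hpos xU; have [->|x_neq0] := eqVneq x 0; first by rewrite linear0l.
exact/ltW/hpos.
Qed.

(** An orthonormal basis of U, obtained by splitting off normalized vectors.  Only
    the expansion of vectors in it is recorded, since this suffices to compute
    traces and to represent linear forms on U. *)
Lemma exists_frame (U : {vspace V}) : positive_on h U ->
  exists2 s, {subset s <= U} & {in U, forall x, x = \sum_(e <- s) h x e *: e}.
Proof.
have [n] := ubnP (\dim U); elim: n => // n IHn in U *; rewrite ltnS => dimU hpos.
have [U0|U_neq0] := eqVneq U 0%VS.
  by exists [::] => // x; rewrite U0 memv0 => /eqP->; rewrite big_nil.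
pose w := vpick U; have wU : w \in U by apply: memv_pick.
have w_neq0 : w != 0 by rewrite vpick0.
have hww := hpos w wU w_neq0.
pose u := (Num.sqrt (h w w))^-1 *: w.
have uU : u \in U by rewrite memvZ.
have huu : h u u = 1.
  rewrite linearZl_LR linearZr_LR /= mulrA -expr2 exprVn sqr_sqrtr ?(ltW hww) //.
  by rewrite mulVf // gt_eqF.
have [||s sU' frame_s] := IHn (U :&: orthov h <[u]>)%VS.
- apply: leq_trans dimU; rewrite ltnNge; apply/negP => le_dim.
  have : u \in (U :&: orthov h <[u]>)%VS.
    suff -> : (U :&: orthov h <[u]> = U)%VS by [].
    by apply/eqP; rewrite eqEdim capvSl le_dim.
  by rewrite memv_cap => /andP[_]; rewrite mem_orthov1 huu oner_eq0.
- by move=> x /memv_capP[xU _]; apply: hpos.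
exists (u :: s) => [x|x xU].
  by rewrite inE => /predU1P[-> //|/sU' /memv_capP[]].
rewrite big_cons -[LHS](subrK (h x u *: u)) addrC; congr (_ + _).
rewrite [LHS]frame_s; last first.
  rewrite memv_cap memvB ?memvZ //= mem_orthov1 linearBl linearZl_LR /= huu mulr1.
  by rewrite subrr.
apply: eq_big_seq => e /sU' /memv_capP[_]; rewrite mem_orthov1_sym mem_orthov1.
by move=> /eqP hue; rewrite linearBl linearZl_LR /= hue mulr0 subr0.
Qed.

Lemma frame_form s x y : y = \sum_(e <- s) h y e *: e ->
  h x y = \sum_(e <- s) h y e * h x e.
Proof. by move=> {1}->; rewrite linear_sumr; apply: eq_bigr => e _; rewrite linearZr_LR. Qed.

(** For a frame s this is the trace of the composite of the adjoint of S with T;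
    for S and T skew it is minus the trace form. *)
Definition hs_form s S T : R := \sum_(e <- s) h (S e) (T e).

Lemma hs_formC s S T : hs_form s S T = hs_form s T S.
Proof. by apply: eq_bigr => e _; rewrite symmC. Qed.

Lemma hs_form_linearl s T : linear_for *%R (hs_form s ^~ T).
Proof.
move=> a S S'; rewrite /hs_form mulr_sumr -big_split; apply: eq_bigr => e _ /=.
by rewrite add_lfunE scale_lfunE linearDl linearZl_LR.
Qed.

Lemma hs_form_linearr s S : linear_for *%R (hs_form s S).
Proof. by move=> a T T'; rewrite !(hs_formC s S) hs_form_linearl. Qed.

Lemma hs_formNl s S T : hs_form s (- S) T = - hs_form s S T.
Proof.
by rewrite /hs_form -sumrN; apply: eq_bigr => e _; rewrite opp_lfunE linearNl.
Qed.

Lemma hs_formDl s S S' T : hs_form s (S + S') T = hs_form s S T + hs_form s S' T.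
Proof. by have := hs_form_linearl s T 1 S S'; rewrite scale1r mul1r. Qed.

(** This is the cyclicity of the trace: moving Y across the form costs a sign both
    for composition on the left, directly by skewness, and for composition on the
    right, where Y e is expanded in the frame. *)
Lemma hs_form_skew s S T Y : (forall x, x = \sum_(e <- s) h x e *: e) ->
  (forall x y, h (Y x) y = - h x (Y y)) ->
  hs_form s (commutator Y S) T = - hs_form s S (commutator Y T).
Proof.
move=> frame_s skewY; rewrite !(hs_formC s S) /commutator !(hs_formDl, hs_formNl).
have left_skew S' T' : hs_form s (Y \o S')%VF T' = - hs_form s (Y \o T')%VF S'.
  rewrite (hs_formC _ (Y \o T')%VF) /hs_form -sumrN; apply: eq_bigr => e _.
  by rewrite !comp_lfunE skewY.
have right_expand S' T' : hs_form s (S' \o Y)%VF T' =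
    \sum_(e <- s) \sum_(f <- s) h (Y e) f * h (S' f) (T' e).
  apply: eq_bigr => e _; rewrite comp_lfunE (frame_s (Y e)) linear_sum linear_sumlz.
  by rewrite -(frame_s (Y e)); apply: eq_bigr => f _; rewrite linearZ linearZl_LR.
have right_skew S' T' : hs_form s (S' \o Y)%VF T' = - hs_form s (T' \o Y)%VF S'.
  rewrite !right_expand exchange_big -sumrN; apply: eq_bigr => e _.
  rewrite -sumrN; apply: eq_bigr => f _.
  by rewrite skewY symmC mulNr [h (S' _) _]symmC.
by rewrite left_skew right_skew opprD opprK.
Qed.

End Frames.

Section PullbackForm.
Variables (R : realType) (g V : vectType R) (h : {symmetric V}) (s : seq V).
Variable rho : 'Hom(g, 'End(V)).

Definition pullback_form (x y : g) : R := hs_form h s (rho x) (rho y).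

Lemma pullback_form_bilinear : bilinear_for *%R *%R pullback_form.
Proof.
split=> [y|x] a u w; rewrite /pullback_form linearP.
  by rewrite hs_form_linearl.
by rewrite hs_form_linearr.
Qed.

HB.instance Definition _ :=
  bilinear_isBilinear.Build R _ _ _ *%R *%R pullback_form pullback_form_bilinear.

Lemma pullback_form_sym x y :
  pullback_form x y = (-1) ^+ false * idfun (pullback_form y x).
Proof. by rewrite expr0 mul1r /pullback_form hs_formC. Qed.

HB.instance Definition _ :=
  isHermitianSesquilinear.Build R _ false idfun pullback_form pullback_form_sym.

(** For s a frame and rho a skew representation, minus the trace form of rho. *)
Definition pullback : {symmetric g} := pullback_form.

Lemma pullbackE x y : pullback x y = hs_form h s (rho x) (rho y).
Proof. by []. Qed.

Hypotheses (hpos : positive_on h fullv) (frame_s : forall x, x = \sum_(e <- s) h x e *: e).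

Lemma pullback_ge0 x : 0 <= pullback x x.
Proof.
rewrite pullbackE sumr_ge0 // => e _.
by rewrite (positive_on_ge0 hpos) ?memvf.
Qed.

Lemma pullback_eq0 x : pullback x x = 0 -> rho x = 0.
Proof.
rewrite pullbackE => /eqP; rewrite psumr_eq0; last first.
  by move=> e _; rewrite (positive_on_ge0 hpos) ?memvf.
move=> /allP rho_x0; apply/lfunP => y; rewrite zero_lfunE (frame_s y) linear_sum.
apply: big1_seq => e /andP[_ /rho_x0 /eqP hxx]; rewrite linearZ /=.
by rewrite (positive_on_eq0 hpos (memvf _) hxx) scaler0.
Qed.

End PullbackForm.

(** * Skew endomorphisms of a space of index at most one *)

Section IndexLe1.
Variables (R : realType) (V : vectType R) (M : metric V).
Implicit Types (x y e f u w : V) (P N S : 'End(V)).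

(** This excludes negative definite planes while avoiding dimensions, and passes
    to orthogonal summands at once. *)
Definition index_le1 : Prop :=
  forall p q, M p p < 0 -> M q q < 0 -> M p q <> 0.

Lemma metric_index1_le1 : metric_index M 1 -> index_le1.
Proof.
move=> [_ max1] p q pneg qneg pq0.
have comb a b : M (a *: p + b *: q) (a *: p + b *: q) =
    a ^+ 2 * M p p + b ^+ 2 * M q q.
  rewrite !(linearDl, linearDr, linearZl_LR, linearZr_LR) /= pq0 (metricC M q p) pq0.
  by rewrite !mulr0 addr0 add0r !mulrA -!expr2.
have freepq : free [:: p; q].
  rewrite free_cons seq1_free span_seq1; apply/andP; split.
    apply/vlineP => -[a pE]; move: pq0; rewrite pE linearZl_LR /= => /eqP.
    rewrite mulf_eq0 (lt_eqF qneg) orbF => /eqP a0.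
    by move: pneg; rewrite pE a0 scale0r linear0l ltxx.
  by apply: contraTneq qneg => ->; rewrite linear0l ltxx.
have := max1 <<[:: p; q]>>%VS; rewrite (eqP freepq) /= => le21.
suff /le21 : negative_definite M <<[:: p; q]>>%VS by [].
move=> x; rewrite span_cons span_seq1 => /memv_addP[_ /vlineP[a ->]].
case=> _ /vlineP[b ->] ->; rewrite comb => ab_neq0.
have [a0|a_neq0] := eqVneq a 0.
  have [b0|b_neq0] := eqVneq b 0.
    by move: ab_neq0; rewrite a0 b0 !scale0r addr0 eqxx.
  by rewrite a0 expr0n mul0r add0r pmulr_rlt0 // exprn_even_gt0.
rewrite ltr_nwDl ?pmulr_rlt0 ?exprn_even_gt0 //.
by rewrite mulr_ge0_le0 ?sqr_ge0 ?ltW.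
Qed.

(** On the line y + s w the square is an affine function of s, nonconstant as w is
    null and not orthogonal to y. *)
Lemma null_shift_negative w y :
  M w w = 0 -> M w y != 0 -> exists s, M (y + s *: w) (y + s *: w) < 0.
Proof.
move=> ww0 wy_neq0.
(* This value of s makes the square equal to -1. *)
exists (- (M y y + 1) / (2 * M w y)).
set a := - _ / _; have aE : a * M w y = - (M y y + 1) / 2 by rewrite /a; field.
rewrite !(linearDl, linearDr, linearZl_LR, linearZr_LR) /= ww0 (metricC M y w) aE.
lra.
Qed.

Lemma metric_neq0 w : w != 0 -> exists y, M w y != 0.
Proof.
move=> w_neq0; apply: boolp.contrapT => none; case/eqP: w_neq0.
apply: (metric_eq0 (M := M)) => y; have [//|Mwy] := eqVneq (M w y) 0.
by case: none; exists y.
Qed.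

Lemma no_negative_positive : (forall x, 0 <= M x x) -> positive_on M fullv.
Proof.
move=> nneg x _ x_neq0; rewrite lt_def nneg andbT; apply/eqP => xx0.
have [y Mxy] := metric_neq0 x_neq0.
have [s] := null_shift_negative xx0 Mxy.
by rewrite ltNge nneg.
Qed.

Hypothesis M_index : index_le1.

(** The orthogonal complement of a negative vector u is positive definite: a null
    vector w in it would pair with some y' orthogonal to u, and shifting y' along w
    would give a negative vector orthogonal to u. *)
Lemma null_orth_negative u w : M u u < 0 -> M u w = 0 -> M w w = 0 -> w = 0.
Proof.
move=> uneg uw0 ww0; have [//|/metric_neq0[y Mwy]] := eqVneq w 0.
pose y' := y - (M u y / M u u) *: u.
have uy'0 : M u y' = 0.
  by rewrite linearBr linearZr_LR /= divfK ?subrr // lt_eqF.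
have Mwy' : M w y' != 0.
  by rewrite linearBr linearZr_LR /= (metricC M w u) uw0 mulr0 subr0.
have [s yneg] := null_shift_negative ww0 Mwy'; case: (M_index uneg yneg).
by rewrite linearDr linearZr_LR /= uy'0 uw0 mulr0 addr0.
Qed.

(** A negative vector u cannot be orthogonal to e, so some f - a e is orthogonal to
    u; it is null, hence zero. *)
Lemma null_collinear e f :
  e != 0 -> M e e = 0 -> M f f = 0 -> M e f = 0 -> exists a, f = a *: e.
Proof.
move=> e_neq0 ee0 ff0 ef0.
have [y /(null_shift_negative ee0)[s]] := metric_neq0 e_neq0.
set u := y + _ => uneg.
have ue_neq0 : M u e != 0.
  by apply: contraNneq e_neq0 => ue0; rewrite (null_orth_negative uneg ue0 ee0).
exists (M u f / M u e); apply/eqP; rewrite -subr_eq0; apply/eqP.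
apply: (null_orth_negative uneg).
  by rewrite linearBr linearZr_LR /= divfK ?subrr.
rewrite !(linearBl, linearBr, linearZl_LR, linearZr_LR) /= ff0 (metricC M f e) ef0 ee0.
by rewrite !(mulr0, subr0).
Qed.

(** The image of N is totally isotropic, hence spanned by some N x; then
    M (N x) y = - M x (N y) is a multiple of M x (N x), which vanishes by
    skewness. *)
Lemma skew_square_eq0 N : Defs.skew M N -> (forall x, N (N x) = 0) -> N = 0.
Proof.
move=> Nskew NN0; apply/lfunP => x; rewrite zero_lfunE.
have img0 y z : M (N y) (N z) = 0 by rewrite Nskew NN0 linear0r oppr0.
have [//|Nx_neq0] := eqVneq (N x) 0; have [y Nxy] := metric_neq0 Nx_neq0.
have [a Ny] := null_collinear Nx_neq0 (img0 x x) (img0 y y) (img0 x y).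
have xNx0 : M x (N x) = 0.
  have := Nskew x x; rewrite metricC => /eqP; rewrite -addr_eq0 -mulr2n mulrn_eq0 /=.
  by move/eqP.
by move: Nxy; rewrite Nskew Ny linearZr_LR /= xNx0 mulr0 oppr0 eqxx.
Qed.

Variables (I : Type) (rho : I -> 'End(V)).
Hypotheses (rho_skew : forall Z, Defs.skew M (rho Z))
  (rho_no_trivial : forall x, (forall Z, rho Z x = 0) -> x = 0).

(** The image of P is totally isotropic and stable under rho.  If M (P x) x were
    nonzero, then P x would span this image and rho Z (P x) = a P x; but
    M (rho Z (P x)) x vanishes, as rho Z P is skew, so a = 0 and P x would be killed
    by every rho Z.  Hence the quadratic form of P is zero. *)
Lemma sym_square_eq0 P :
  (forall x y, M (P x) y = M x (P y)) ->
  (forall Z x, rho Z (P x) = P (rho Z x)) ->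
  (forall x, P (P x) = 0) -> P = 0.
Proof.
move=> Psym Pcomm PP0.
have img0 y z : M (P y) (P z) = 0 by rewrite Psym PP0 linear0r.
have quad0 x : M (P x) x = 0.
  have [//|Pxx] := eqVneq (M (P x) x) 0.
  have Px_neq0 : P x != 0 by apply: contraNneq Pxx => ->; rewrite linear0l.
  case/eqP: (Px_neq0); apply: rho_no_trivial => Z.
  have [a PZx] := null_collinear Px_neq0 (img0 x x) (img0 _ _) (img0 x (rho Z x)).
  rewrite Pcomm PZx; suff -> : a = 0 by rewrite scale0r.
  apply: (mulIf Pxx); rewrite mul0r -[LHS]linearZl_LR -PZx /=.
  have : M (P (rho Z x)) x = - M (P (rho Z x)) x.
    by rewrite {1}Psym rho_skew Pcomm metricC.
  by move/eqP; rewrite -addr_eq0 -mulr2n mulrn_eq0 /= => /eqP.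
apply/lfunP => x; rewrite zero_lfunE; apply: (metric_eq0 (M := M)) => y.
have := quad0 (x + y); rewrite (linearD P) linearDl !linearDr /= !quad0 add0r addr0.
rewrite (Psym y x) (metricC M y) => /eqP; rewrite -mulr2n mulrn_eq0 /=.
by move/eqP.
Qed.

(** Squaring P halves its nilpotency order and keeps it symmetric and commuting with
    rho, so the case of order two suffices. *)
Lemma sym_nilpotent_eq0 P k :
  (forall x y, M (P x) y = M x (P y)) ->
  (forall Z x, rho Z (P x) = P (rho Z x)) ->
  (forall x, iter k P x = 0) -> P = 0.
Proof.
have [n] := ubnP k; elim: n k P => // n IHn k P; rewrite ltnS => k_le Psym Pcomm Pk0.
have [k_le1|k_gt1] := leqP k 1.
  apply/lfunP => x; rewrite zero_lfunE; have := Pk0 x.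
  by case: k k_le1 {k_le Pk0} => [|[|//]] _ //= ->; exact: linear0.
have iterPP j x : iter j (P \o P)%VF x = iter j.*2 P x.
  by elim: j => //= j ->; rewrite comp_lfunE.
apply: sym_square_eq0 => // x.
suff /lfunP/(_ x) : (P \o P = 0)%VF by rewrite comp_lfunE zero_lfunE.
apply: (IHn (uphalf k)) => [|y z|Z y|y].
- by lia.
- by rewrite !comp_lfunE !Psym.
- by rewrite !comp_lfunE !Pcomm.
rewrite iterPP; have -> : ((uphalf k).*2 = ((uphalf k).*2 - k) + k)%N by lia.
rewrite iterD Pk0; elim: (_ - k)%N => //= j ->; exact: linear0.
Qed.

(** The square of N is symmetric and nilpotent, so it vanishes. *)
Lemma skew_nilpotent_eq0 N k : Defs.skew M N ->
  (forall Z x, rho Z (N x) = N (rho Z x)) ->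
  (forall x, iter k N x = 0) -> N = 0.
Proof.
move=> Nskew Ncomm Nk0; apply: skew_square_eq0 => // x.
suff /lfunP/(_ x) : (N \o N = 0)%VF by rewrite comp_lfunE zero_lfunE.
have iterNN j y : iter j (N \o N)%VF y = iter j N (iter j N y).
  by rewrite -iterD addnn; elim: j => //= j ->; rewrite comp_lfunE.
apply: (@sym_nilpotent_eq0 _ k) => [y z|Z y|y].
- by rewrite !comp_lfunE !Nskew opprK.
- by rewrite !comp_lfunE !Ncomm.
by rewrite iterNN Nk0; elim: k {Nk0} => //= j ->; exact: linear0.
Qed.

End IndexLe1.

(** * Lie algebras with a positive definite invariant form *)

Lemma commutatorE (F : fieldType) (V : vectType F) (A B : 'End(V)) x :
  commutator A B x = A (B x) - B (A x).
Proof. by rewrite add_lfunE opp_lfunE !comp_lfunE. Qed.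

Section LieAlgebra.
Variables (F : fieldType) (g : vectType F) (L : lie_algebra g).
Implicit Types (U W K I J : {vspace g}).

Lemma lie_antisym x y : L x y = - L y x.
Proof.
have := lie_alternating L (x + y).
rewrite !linearD /= !add_lfunE !lie_alternating add0r addr0 addrC => /eqP.
by rewrite addr_eq0 => /eqP.
Qed.

Lemma lie_ad_morph x y : L (L x y) = commutator (L x) (L y).
Proof.
apply/lfunP => z; rewrite commutatorE.
have := lie_jacobi L x y z; rewrite (lie_antisym z (L x y)) (lie_antisym z x) linearN.
by move/eqP; rewrite subr_eq0 => /eqP.
Qed.

Lemma lie_centerP x : reflect (forall y, L x y = 0) (x \in lie_center L).
Proof.
rewrite memv_ker; apply: (iffP eqP) => [->|Lx0] => [y|]; first exact: zero_lfunE.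
by apply/lfunP => y; rewrite zero_lfunE.
Qed.

Lemma lie_prod_sub U W K :
  (forall x y, x \in U -> y \in W -> L x y \in K) -> (lie_prod L U W <= K)%VS.
Proof.
move=> LK; apply/span_subvP => _ /allpairsP[[x y] /= [xU yW ->]].
by apply: LK; apply: vbasis_mem.
Qed.

Lemma mem_derived x y : L x y \in lie_derived L.
Proof. by apply: mem_lie_prod; rewrite memvf. Qed.

Lemma derivation_derived (A : 'End(g)) :
  (forall x y, A (L x y) = L (A x) y + L x (A y)) ->
  {in lie_derived L, forall x, A x \in lie_derived L}.
Proof.
move=> Ader x; rewrite memv_preim; apply/subvP/lie_prod_sub => {}x y _ _.
by rewrite -memv_preim Ader memvD ?mem_derived.
Qed.

Lemma lie_ideal_prod W I : lie_ideal L W I -> lie_ideal L W (lie_prod L I I).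
Proof.
move=> [IW WI]; have WI_sub w x : w \in W -> x \in I -> L w x \in I.
  by move=> wW xI; apply: (subvP WI); apply: mem_lie_prod.
split.
  apply/(subv_trans _ IW)/lie_prod_sub => x y xI yI.
  by apply: WI_sub => //; apply: (subvP IW).
apply: lie_prod_sub => w x wW; rewrite memv_preim; apply: (subvP _ x).
apply: lie_prod_sub => {}x y xI yI; rewrite -memv_preim.
have -> : L w (L x y) = L (L w x) y + L x (L w y).
  by rewrite lie_ad_morph commutatorE subrK.
by rewrite memvD ?mem_lie_prod ?WI_sub.
Qed.

End LieAlgebra.

Section CompactLieAlgebra.
Variables (R : realType) (g : vectType R) (L : lie_algebra g) (h : {symmetric g}).
Hypotheses (hpos : positive_on h fullv)
  (hinv : forall z x y, h (L z x) y = - h x (L z y)).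
Local Notation gbar := (lie_derived L).
Local Notation c := (lie_center L).

Lemma center_orth_derived x y : x \in c -> y \in gbar -> h x y = 0.
Proof.
move=> /lie_centerP Lx0 yg; apply/eqP.
rewrite symmC -mem_orthov1; apply: (subvP _ y yg); apply: lie_prod_sub => a b _ _.
by rewrite mem_orthov1 hinv lie_antisym Lx0 oppr0 linear0r oppr0.
Qed.

(** The square of [x, y] is h x [y, [x, y]] by invariance, hence zero. *)
Lemma orth_derived_center x : {in gbar, forall y, h x y = 0} -> x \in c.
Proof.
move=> xorth; apply/lie_centerP => y; apply: (positive_on_eq0 hpos (memvf _)).
by rewrite {1}lie_antisym linearNl /= hinv xorth ?mem_derived // !oppr0.
Qed.

Lemma derived_center_eq0 x : x \in gbar -> x \in c -> x = 0.
Proof.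
move=> xg xc; apply: (positive_on_eq0 hpos (memvf _)).
exact: center_orth_derived.
Qed.

Lemma positive_on_derived : positive_on h gbar.
Proof. by move=> x _; apply: hpos; rewrite memvf. Qed.

Lemma derived_center_decomp x : exists2 y, y \in gbar & x - y \in c.
Proof.
have [s sg frame_s] := exists_frame positive_on_derived.
exists (\sum_(e <- s) h x e *: e).
  by rewrite big_seq memv_suml // => e /sg eg; rewrite memvZ.
apply: orth_derived_center => y yg; rewrite linearBl linear_sumlz /=.
rewrite (frame_form x (frame_s y yg)) -sumrB big1 // => e _.
by rewrite linearZl_LR /= (symmC h e) mulrC subrr.
Qed.

Lemma derived_add_center : (gbar + c)%VS = fullv.
Proof.
apply/eqP; rewrite eqEsubv subvf; apply/subvP => x _.
have [y yg xyc] := derived_center_decomp x.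
by rewrite -[x](subrK y) addrC memv_add.
Qed.

Lemma directv_derived_center : directv (gbar + c).
Proof.
apply/directv_addP/eqP; rewrite -subv0; apply/subvP => x /memv_capP[xg xc].
by rewrite memv0 (derived_center_eq0 xg xc).
Qed.

(** For x in J and y in [g, g] the square of [x, y] is - h y [x, [x, y]], which is
    zero because [x, y] lies in J; so x is central. *)
Lemma abelian_ideal_eq0 J : lie_ideal L gbar J -> lie_prod L J J = 0%VS -> J = 0%VS.
Proof.
move=> [Jg gJ] JJ0; apply/eqP; rewrite -subv0; apply/subvP => x xJ.
have LJ0 y z : y \in J -> z \in J -> L y z = 0.
  by move=> yJ zJ; apply/eqP; rewrite -memv0 -JJ0 mem_lie_prod.
rewrite memv0; apply/eqP/derived_center_eq0; first exact: (subvP Jg).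
apply/lie_centerP => w; have [y yg /lie_centerP wyc] := derived_center_decomp w.
have -> : L x w = L x y.
  by apply/eqP; rewrite -subr_eq0 -linearB /= lie_antisym wyc oppr0.
have xyJ : L x y \in J.
  rewrite lie_antisym memvN; apply: (subvP gJ); exact: mem_lie_prod.
by apply: (positive_on_eq0 hpos (memvf _)); rewrite hinv LJ0 // linear0r oppr0.
Qed.

Lemma derived_semisimple : lie_semisimple L gbar.
Proof.
move=> J Jideal [k]; elim: k J Jideal => [//|k IHk] J Jideal; rewrite iterSr => Jk0.
by apply: abelian_ideal_eq0 => //; apply: IHk => //; apply: lie_ideal_prod.
Qed.

(** On [g, g] the Killing form is negative definite, so the linear form
    y |-> tr (A o ad y) is represented there by some x0.  The derivation
    E = A - ad x0 is then orthogonal to every ad y for the trace form.  As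
    ad (E y) = [E, ad y], cyclicity of the trace gives that E y has Killing square
    zero, so E takes values in the center; since E also preserves [g, g], it
    vanishes there, and on c both A and ad x0 vanish. *)
Lemma derivation_inner (A : 'End(g)) :
  (forall x y, A (L x y) = L (A x) y + L x (A y)) ->
  {in c, forall x, A x = 0} -> exists2 x, x \in gbar & A = L x.
Proof.
move=> Ader Ac0; have [s _ /(_ _ (memvf _)) frame_s] := exists_frame hpos.
pose k := pullback h s L.
have kpos : positive_on k gbar.
  move=> x xg x_neq0; rewrite lt_def (pullback_ge0 _ _ hpos) andbT.
  apply: contraNneq x_neq0 => /(pullback_eq0 hpos frame_s) Lx0.
  by rewrite (derived_center_eq0 xg) // memv_ker Lx0.
have [t tg frame_t] := exists_frame kpos.
pose f y := hs_form h s A (L y).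
have flin : linear_for *%R f by move=> a y z; rewrite /f linearP hs_form_linearr.
pose x0 := \sum_(e <- t) f e *: e.
have x0g : x0 \in gbar by rewrite /x0 big_seq memv_suml // => e /tg eg; rewrite memvZ.
exists x0 => //.
pose E := A - L x0.
have f_rep y : y \in gbar -> hs_form h s (L x0) (L y) = f y.
  move=> yg; rewrite -pullbackE -/k /x0 linear_sumlz.
  pose fL := GRing.isLinear.Build _ _ _ _ f flin.
  pose F : {linear g -> R | *%R} := HB.pack f fL.
  rewrite -[RHS]/(F y) [in RHS](frame_t y yg) linear_sum.
  by apply: eq_bigr => e _; rewrite linearZl_LR linearZ_LR /= (symmC k y) mulrC.
have E_orth y : hs_form h s E (L y) = 0.
  have [y1 y1g y2c] := derived_center_decomp y.
  have -> : L y = L y1 by apply/eqP; rewrite -subr_eq0 -linearB -memv_ker.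
  by rewrite hs_formDl hs_formNl f_rep // subrr.
have Eder x y : E (L x y) = L (E x) y + L x (E y).
  have x0der : L x0 (L x y) = L (L x0 x) y + L x (L x0 y).
    by rewrite lie_ad_morph commutatorE subrK.
  rewrite !add_lfunE !opp_lfunE Ader x0der !linearD !linearN /=.
  by rewrite !add_lfunE !opp_lfunE addrACA.
have E_bracket y : L (E y) = commutator E (L y).
  by apply/lfunP => z; rewrite commutatorE Eder addrK.
have E_center y : E y \in c.
  rewrite memv_ker; apply/eqP/(pullback_eq0 hpos frame_s).
  rewrite pullbackE {1}E_bracket.
  have -> : commutator E (L y) = - commutator (L y) E by rewrite /commutator opprB.
  rewrite hs_formNl (hs_form_skew _ _ frame_s (hinv y)) opprK.
  by rewrite -lie_ad_morph E_orth.
apply/eqP; rewrite -subr_eq0 -/E; apply/eqP/lfunP => y; rewrite zero_lfunE.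
have [y1 y1g y2c] := derived_center_decomp y.
have Ey1 : E y1 = 0 by apply: derived_center_eq0 => //; apply: derivation_derived.
rewrite -[y](subrK y1) (linearD E) /= Ey1 addr0.
have : E (y - y1) = A (y - y1) - L x0 (y - y1) by rewrite add_lfunE opp_lfunE.
by rewrite Ac0 // lie_antisym; move/lie_centerP: y2c => ->; rewrite oppr0 subr0.
Qed.

End CompactLieAlgebra.

(** * Skew derivations of the 2-step nilpotent Lie algebra *)

Section PairEnd.
Variables (F : fieldType) (V W : vectType F).
Implicit Types (A : 'End(V)) (B : 'End(W)).

Lemma pair_endD A A' B B' :
  pair_end A B + pair_end A' B' = pair_end (A + A') (B + B').
Proof. by apply/lfunP => p; rewrite add_lfunE !pair_endE !add_lfunE. Qed.

Lemma pair_end_inj A A' B B' : pair_end A B = pair_end A' B' -> A = A' /\ B = B'.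
Proof.
move=> eqAB; split; apply/lfunP => x.
  by have := congr1 (fun T : 'End((V * W)%type) => (T (x, 0)).1) eqAB; rewrite !pair_endE.
by have := congr1 (fun T : 'End((V * W)%type) => (T (0, x)).2) eqAB; rewrite !pair_endE.
Qed.

Lemma pair_end0 : pair_end (0 : 'End(V)) (0 : 'End(W)) = 0.
Proof. by apply/lfunP => p; rewrite pair_endE !zero_lfunE. Qed.

Lemma commutator_pair_end A A' B B' :
  commutator (pair_end A B) (pair_end A' B') =
  pair_end (commutator A A') (commutator B B').
Proof.
by apply/lfunP => p; rewrite commutatorE !pair_endE /= !commutatorE.
Qed.

End PairEnd.

Section DataSet.
Variables (R : realType) (g v : vectType R) (D : data_set g v).
Local Notation n := (g * v)%type.
Local Notation L := (ds_lie D).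
Local Notation Mg := (ds_gmetric D).
Local Notation Mv := (ds_vmetric D).
Local Notation Mn := (n_metric D).
Local Notation pi := (ds_pi D).
Local Notation gbar := (lie_derived L).
Local Notation c := (lie_center L).

Lemma n_metricE p q : Mn p q = Mg p.1 q.1 + Mv p.2 q.2.
Proof. by []. Qed.

Lemma n_bracket_metric p q Z : Mg (n_lie D p q).1 Z = Mv (pi Z p.2) q.2.
Proof. by rewrite /= n_adE /= sharpE n_pairingE. Qed.

Lemma n_bracket2 p q : (n_lie D p q).2 = 0.
Proof. by rewrite /= n_adE. Qed.

Lemma n_centerP p : (forall q, n_lie D p q = 0) -> p.2 = 0.
Proof.
move=> pc; apply: (ds_pi_no_trivial (d := D)) => Z.
apply: (metric_eq0 (M := Mv)) => Y.
by rewrite -(n_bracket_metric p (0, Y)) pc linear0l.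
Qed.

Lemma pi_eq0 Z : pi Z = 0 -> Z = 0.
Proof. by move=> piZ0; apply: (@ds_pi_faithful _ _ _ D); rewrite piZ0 linear0. Qed.

(** Pairing the Leibniz rule for (0, X) and (0, Y) with Z in g turns it into the
    identity [B, pi Z] = pi (A Z), tested against X and Y. *)
Lemma h_autP A B : h_aut D (pair_end A B) <->
  [/\ Defs.skew Mg A, Defs.skew Mv B & forall Z, commutator B (pi Z) = pi (A Z)].
Proof.
split=> [[der skewAB] | [skewA skewB BA]].
  have skewA : Defs.skew Mg A.
    move=> x y; have := skewAB (x, 0) (y, 0).
    by rewrite !n_metricE !pair_endE /= !linear0 ?linear0l ?linear0 !addr0.
  have skewB : Defs.skew Mv B.
    move=> x y; have := skewAB (0, x) (0, y).
    by rewrite !n_metricE !pair_endE /= !linear0 ?linear0l ?linear0 !add0r.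
  split=> // Z; apply/lfunP => X; rewrite commutatorE.
  apply/eqP; rewrite -subr_eq0; apply/eqP; apply: (metric_eq0 (M := Mv)) => Y.
  have := congr1 (fun p : n => Mg p.1 Z) (der (0, X) (0, Y)).
  rewrite pair_endE /= skewA n_bracket_metric linearDl /= !n_bracket_metric.
  rewrite !pair_endE /= !linearBl /= skewB => eqA; lra.
split=> [p q|p q]; last first.
  by rewrite !n_metricE !pair_endE /= skewA skewB opprD.
apply/eqP; rewrite -subr_eq0; apply/eqP/pair_equal_spec; split; last first.
  by rewrite /= !pair_endE /= !n_bracket2 linear0 addr0 subr0.
apply: (metric_eq0 (M := Mg)) => Z; rewrite /= linearBl linearDl /= !n_bracket_metric.
rewrite !pair_endE /= skewA n_bracket_metric -BA.
rewrite commutatorE linearBl /= skewB; lra.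
Qed.

(** A derivation preserves the center of n, which is g because v has no trivial
    subrepresentation; a skew endomorphism then preserves its orthogonal
    complement v. *)
Lemma h_aut_pair T : h_aut D T -> exists A B, T = pair_end A B.
Proof.
move=> [der skewT].
have T_center Z : (T (Z, 0)).2 = 0.
  apply: n_centerP => q; have := der (Z, 0) q.
  by rewrite !n_lie_central linear0 addr0.
have T_orth X : (T (0, X)).1 = 0.
  apply: (metric_eq0 (M := Mg)) => Z; have := skewT (0, X) (Z, 0).
  by rewrite !n_metricE /= linear0r addr0 T_center linear0l linear0r addr0 oppr0.
have lin1 : linear (fun Z => (T (Z, 0)).1).
  move=> a x y; have -> : (a *: x + y, 0) = a *: (x, 0) + (y, 0) :> n.
    by apply/pair_equal_spec; rewrite /= scaler0 addr0.
  by rewrite linearP.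
have lin2 : linear (fun X => (T (0, X)).2).
  move=> a x y; have -> : (0, a *: x + y) = a *: (0, x) + (0, y) :> n.
    by apply/pair_equal_spec; rewrite /= scaler0 addr0.
  by rewrite linearP.
exists (linfun (fun Z => (T (Z, 0)).1)), (linfun (fun X => (T (0, X)).2)).
apply/lfunP => -[Z X]; rewrite pair_endE /= !linfun_linearE //.
have -> : (Z, X) = (Z, 0) + (0, X) :> n by apply/pair_equal_spec; rewrite /= addr0 add0r.
rewrite linearD; apply/pair_equal_spec; split=> /=.
  by rewrite T_orth addr0.
by rewrite T_center add0r.
Qed.

(** This is the Jacobi identity in End(v), transported by the faithful pi. *)
Lemma derivation_of_pair (A : 'End(g)) (B : 'End(v)) :
  (forall Z, commutator B (pi Z) = pi (A Z)) ->
  forall x y, A (L x y) = L (A x) y + L x (A y).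
Proof.
move=> BA x y.
suff : pi (A (L x y)) = pi (L (A x) y + L x (A y)) by apply: ds_pi_faithful.
rewrite -BA linearD /= !(ds_pi_morph D) -!BA; apply/lfunP => X.
rewrite [RHS]add_lfunE !commutatorE (linearB B) (linearB (pi x)) (linearB (pi y)) /= !opprB.
rewrite [RHS]addrACA !subrKA addrACA [- _ - _]addrC addrACA //.
Qed.

Hypothesis Dlor : lorentzian D.

Lemma lorentzian_index : index_le1 Mn.
Proof. exact: metric_index1_le1. Qed.

Lemma vmetric_index : index_le1 Mv.
Proof.
move=> p q pneg qneg pq0; apply: (lorentzian_index (p := (0, p)) (q := (0, q)));
  by rewrite n_metricE /= linear0l add0r.
Qed.

(** Whichever of g and v is positive definite provides the form: the metric of g
    itself, or minus the trace form of pi. *)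
Lemma exists_invariant_positive : exists2 h : {symmetric g}, positive_on h fullv &
  forall z x y, h (L z x) y = - h x (L z y).
Proof.
have [[x xneg]|Mg_nneg] := boolp.pselect (exists x, Mg x x < 0); last first.
  exists Mg; last exact: ds_gmetric_invariant.
  apply: no_negative_positive => x; rewrite leNgt; apply/negP => xneg.
  by apply: Mg_nneg; exists x.
have Mv_pos : positive_on Mv fullv.
  apply: no_negative_positive => y; rewrite leNgt; apply/negP => yneg.
  apply: (lorentzian_index (p := (x, 0)) (q := (0, y))); rewrite n_metricE /=.
  - by rewrite linear0l addr0.
  - by rewrite linear0l add0r.
  - by rewrite linear0r linear0l addr0.
have [s _ /(_ _ (memvf _)) frame_s] := exists_frame Mv_pos.
exists (pullback Mv s pi) => [Z _ Z_neq0|Z x' y].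
  rewrite lt_def (pullback_ge0 _ _ Mv_pos) andbT; apply: contraNneq Z_neq0.
  by move/(pullback_eq0 Mv_pos frame_s)/pi_eq0 ->.
rewrite !pullbackE !(ds_pi_morph D) (hs_form_skew _ _ frame_s) //.
exact: ds_vmetric_invariant.
Qed.

(** pi (A Z) is nilpotent, as a commutator of B with pi Z that lies in the
    commuting family pi(c), and it is a skew endomorphism commuting with pi(g). *)
Lemma h_aut_center_eq0 A B :
  h_aut D (pair_end A B) -> {in c, forall Z, A Z = 0}.
Proof.
move=> /h_autP[_ _ BA] Z Zc.
have Ac W : W \in c -> A W \in c.
  move=> /lie_centerP Wc; apply/lie_centerP => y; have := derivation_of_pair BA W y.
  by rewrite !Wc linear0 addr0.
have pi_comm W Y : W \in c -> (pi W \o pi Y)%VF = (pi Y \o pi W)%VF.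
  move=> /lie_centerP/(_ Y) WY; apply/eqP; rewrite -subr_eq0; apply/eqP.
  by rewrite -[LHS](ds_pi_morph D) WY linear0.
have [k pik0] := commutator_nilpotent (BA Z) (BA (A Z)) (pi_comm _ _ Zc)
  (pi_comm _ _ Zc) (pi_comm _ _ (Ac _ Zc)).
have A_comm Y X : pi Y (pi (A Z) X) = pi (A Z) (pi Y X).
  by have /lfunP/(_ X) := pi_comm _ Y (Ac _ Zc); rewrite !comp_lfunE => ->.
exact/pi_eq0/(skew_nilpotent_eq0 vmetric_index (ds_vmetric_invariant D)
  (@ds_pi_no_trivial _ _ _ D) (ds_vmetric_invariant D (A Z)) A_comm pik0).
Qed.

End DataSet.

(** * Decomposition of the skew derivations *)

Theorem theorem4p1 (R : realType) (g v : vectType R) (D : data_set g v)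
    (hL : lorentzian D) :
  let L := ds_lie D in
  let gbar := lie_derived L in
  let c := lie_center L in
  [/\ (gbar + c)%VS = fullv, directv (gbar + c),
      lie_compact L gbar & lie_semisimple L gbar] /\
  [/\ (* Z |-> (ad Z, pi Z) identifies gbar with a subalgebra of End(n) *)
      {in gbar &, injective (g_action D)},
      {in gbar &, forall Z W,
         g_action D (L Z W) = commutator (g_action D Z) (g_action D W)},
      (* h^aut is the direct sum of gbar and u *)
      h_aut D = [set a + b | a in gbar_n D & b in u_n D],
      gbar_n D `&` u_n D = [set 0] &
      (* [gbar, u] = 0 *)
      forall a b, gbar_n D a -> u_n D b -> commutator a b = 0].
Proof.
move=> L gbar c.
have [h hpos hinv] := exists_invariant_positive hL.
have Lad (Z : g) : Defs.skew (ds_gmetric D) (L Z) := ds_gmetric_invariant D Z.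
have u_comm B Z : u_alg D B -> commutator (ds_pi D Z) B = 0.
  by move=> [BEnd _]; rewrite /commutator BEnd subrr.
split; split.
- exact: derived_add_center hpos hinv.
- exact: directv_derived_center hpos hinv.
- by exists h; split=> [|z x y _ _ _]; [exact: positive_on_derived | exact: hinv].
- exact: derived_semisimple hpos hinv.
- by move=> Z W _ _ /pair_end_inj[_]; apply: ds_pi_faithful.
- by move=> Z W _ _; rewrite commutator_pair_end -lie_ad_morph -(ds_pi_morph D).
- apply/seteqP; split=> [T hT | _ [_ [Z Zg <-]] [_ [B [BEnd Bskew] <-]] <-].
    have [A [B defT]] := h_aut_pair hT; rewrite {}defT in hT *.
    have A_center := h_aut_center_eq0 hL hT.
    have /h_autP[_ Bskew BA] := hT.
    have [Z Zg defA] := derivation_inner hpos hinv (derivation_of_pair BA) A_center.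
    exists (g_action D Z); first by exists Z.
    exists (pair_end 0 (B - ds_pi D Z)); last first.
      by rewrite pair_endD addr0 defA [ds_pi D Z + _]addrC subrK.
    exists (B - ds_pi D Z) => //; split=> [W|x y].
      apply/lfunP => X; rewrite !comp_lfunE !add_lfunE !opp_lfunE linearB /=.
      have := congr1 (fun T : 'End(v) => T X) (BA W).
      rewrite defA (ds_pi_morph D) !commutatorE => /(canRL (subrK _)) ->.
      by rewrite addrAC [X in X + _]addrAC subrr add0r addrC.
    rewrite !add_lfunE !opp_lfunE linearBl linearBr /= Bskew ds_vmetric_invariant.
    by rewrite opprD.
  rewrite pair_endD addr0; apply/h_autP; split=> [||W]; first exact: Lad.
    move=> x y; rewrite !add_lfunE linearDl linearDr /= Bskew ds_vmetric_invariant.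
    by rewrite opprD.
  apply/lfunP => X; rewrite (ds_pi_morph D) !commutatorE !add_lfunE linearD /=.
  have := congr1 (fun T : 'End(v) => T X) (BEnd W); rewrite !comp_lfunE => ->.
  by rewrite opprD addrACA subrr addr0.
- apply/seteqP; split=> [_ [[Z Zg <-] [B _ /pair_end_inj[LZ0 _]]] | _ ->].
    suff -> : Z = 0 by rewrite /g_action !linear0 pair_end0.
    apply: (derived_center_eq0 hpos hinv Zg).
    by rewrite memv_ker -LZ0.
  split; last first.
    exists 0; last exact: pair_end0.
    split=> [Z|x y]; first by rewrite comp_lfun0l comp_lfun0r.
    by rewrite !zero_lfunE linear0l linear0r oppr0.
  by exists 0; [exact: mem0v | rewrite /g_action !linear0 pair_end0].
move=> _ _ [Z Zg <-] [B Bu <-].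
rewrite commutator_pair_end u_comm // /commutator.
by rewrite comp_lfun0l comp_lfun0r subrr pair_end0.
Qed.
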